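(* Let $Z_1,\dots,Z_N$ be i.i.d. $C$-valued random variables with law $\pi^x$. Suppose $\tilde J:C\to\mathbb R$ satisfies $|\tilde J(z+F)-\tilde J(z'+F)|\le\kappa\|z-z'\|_\infty$ for all $F\in\mathcal F$, $z,z'\in C$, and $\int_C|\tilde J(z)|\,\pi^x(dz)<\infty$. Suppose the metric probability space $(C,\|\cdot\|_\infty,\pi^x)$ has finite sub-Gaussian diameter $\Delta_{SG}(C)<\infty$. Let $J(F)=\int_C\tilde J(z+F)\,\pi^x(dz)$. Then for any $F\in\mathcal F$ and $\delta\in(0,1)$, with probability at least $1-\delta$, $$J(F)\le\frac1N\sum_{i=1}^N\tilde J(Z_i+F)+\mathbb E\left[\sup_{G\in\mathcal F}\Big\{J(G)-\frac1N\sum_{i=1}^N\tilde J(Z_i+G)\Big\}\right]+\left(\frac{2\kappa^2\Delta_{SG}^2(C)\log(1/\delta)}{N}\right)^{1/2}.$$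
   Context: $C$ is the Banach space of continuous functions $[0,T]\to\mathbb R^d$ with norm $\|x\|_\infty = \max_{1\le i\le d}\sup_{t\in[0,T]}|x_i(t)|$. $\mathcal F\subset C$ is a nonempty convex compact set, and $\pi^x$ is a Borel probability measure on $C$ (the law of a continuous process started at $x\in\mathbb R^d$). Sub-Gaussian diameter: for a metric probability space $(\mathcal X,d,\pi)$ let $X,X'$ be independent with law $\pi$, let $\varepsilon=\pm1$ with probability $1/2$ each, independent of $(X,X')$, and let $\mathcal H=\varepsilon\,d(X,X')$. Then $\Delta_{SG}(\mathcal X)$ is the smallest $\sigma\ge0$ such that $\mathbb E[e^{\lambda\mathcal H}]\le e^{\sigma^2\lambda^2/2}$ for all $\lambda\in\mathbb R$ ($+\infty$ if there is none). *)

(* Defs.v *)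
From HB Require Import structures.
From mathcomp Require Import all_boot all_order all_algebra.
From mathcomp Require Import all_classical all_reals all_analysis.

Set Implicit Arguments.
Unset Strict Implicit.
Unset Printing Implicit Defensive.

Import Order.TTheory GRing.Theory Num.Theory.
Import numFieldNormedType.Exports.

Local Open Scope classical_set_scope.
Local Open Scope ring_scope.

(* C([0,T], R^d). A new type rather than the library's [continuousType], so    *)
(* that it carries the sup norm and not one of the library's other topologies *)
(* on function spaces; [0,T] has the subspace topology.                       *)
Record paths (R : realType) (T : R) (d : nat) := mkpath {
  path_fun :> set_type `[0, T]%classic -> 'rV[R]_d ;
  path_continuous : continuous path_fun }.
Arguments path_continuous {R T d} p x U : rename.

HB.instance Definition _ (R : realType) (T : R) d := gen_eqMixin (paths T d).
HB.instance Definition _ (R : realType) (T : R) d :=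
  gen_choiceMixin (paths T d).

Section paths_lmodType.
Context (R : realType) (T : R) (d : nat).
Local Notation C := (paths T d).
Local Notation I := (set_type `[0, T]%classic).

Lemma pathP (f g : C) : (forall t, f t = g t) -> f = g.
Proof.
case: f g => f cf [g cg] /= /funext fg; rewrite fg in cf *.
by congr mkpath; exact: Prop_irrelevance.
Qed.

Fact path_add_subproof (f g : C) : continuous (fun t => f t + g t).
Proof. by move=> t; exact: (cvgD (path_continuous f t) (path_continuous g t)). Qed.

Fact path_opp_subproof (f : C) : continuous (fun t => - f t).
Proof. by move=> t; exact: (continuousN (path_continuous f t)). Qed.

Fact path_scale_subproof (a : R) (f : C) : continuous (fun t => a *: f t).
Proof. by move=> t; exact: (continuousZl_tmp (k := a) (path_continuous f t)). Qed.

Fact path_zero_subproof : continuous (fun _ : I => 0 : 'rV[R]_d).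
Proof. exact: cst_continuous. Qed.

Definition path_zero := mkpath (@path_zero_subproof).
Definition path_add f g := mkpath (@path_add_subproof f g).
Definition path_opp f := mkpath (@path_opp_subproof f).
Definition path_scale a f := mkpath (@path_scale_subproof a f).

Fact path_addA : associative path_add.
Proof. by move=> f g h; apply: pathP => t; exact: addrA. Qed.

Fact path_addC : commutative path_add.
Proof. by move=> f g; apply: pathP => t; exact: addrC. Qed.

Fact path_add0 : left_id path_zero path_add.
Proof. by move=> f; apply: pathP => t; exact: add0r. Qed.

Fact path_addN : left_inverse path_zero path_opp path_add.
Proof. by move=> f; apply: pathP => t; exact: addNr. Qed.

HB.instance Definition _ :=
  GRing.isZmodule.Build C path_addA path_addC path_add0 path_addN.

Fact path_scaleA a b (f : C) :
  path_scale a (path_scale b f) = path_scale (a * b) f.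
Proof. by apply: pathP => t; exact: scalerA. Qed.

Fact path_scale1 : left_id 1 path_scale.
Proof. by move=> f; apply: pathP => t; exact: scale1r. Qed.

Fact path_scaleDr : right_distributive path_scale +%R.
Proof. by move=> a f g; apply: pathP => t; exact: scalerDr. Qed.

Fact path_scaleDl (f : C) : {morph path_scale^~ f : a b / a + b}.
Proof. by move=> a b; apply: pathP => t; exact: scalerDl. Qed.

HB.instance Definition _ := GRing.Zmodule_isLmodule.Build R C
  path_scaleA path_scale1 path_scaleDr path_scaleDl.

Lemma path_zeroE t : (0 : C) t = 0. Proof. by []. Qed.
Lemma path_addE (f g : C) t : (f + g) t = f t + g t. Proof. by []. Qed.
Lemma path_oppE (f : C) t : (- f) t = - f t. Proof. by []. Qed.
Lemma path_scaleE a (f : C) t : (a *: f) t = a *: f t. Proof. by []. Qed.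

End paths_lmodType.

Section paths_norm.
Context (R : realType) (T : R) (d : nat).
Local Notation C := (paths T d).
Local Notation I := (set_type `[0, T]%classic).

Definition path_norm (f : C) : R :=
  \big[Num.max/0]_(i < d) sup (range (fun t => `|f t ord0 i|)).

Lemma path_coord_bounded (f : C) (i : 'I_d) :
  has_ubound (range (fun t => `|f t ord0 i|)).
Proof.
have cf : {within `[0, T]%classic, continuous (valL (path_fun f))}.
  exact/subspace_valL_continuousP/path_continuous.
have := compact_bounded (continuous_compact cf (@segment_compact _ 0 T)).
move=> [M [_ Mf]]; exists (M + 1) => _ [t _ <-].
have /Mf h : M < M + 1 by rewrite ltrDl.
apply: le_trans (h (f t) _).
  rewrite [leRHS]mx_normrE.
  exact: (le_bigmax _ (fun ij => `|f t ij.1 ij.2|) (ord0, i)).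
exists (val t); first by have := valP t; rewrite inE.
exact: (congr1 (fun g => g t) (valLK point (path_fun f))).
Qed.

Lemma path_norm_ge_coord (f : C) t i : `|f t ord0 i| <= path_norm f.
Proof.
rewrite /path_norm; apply: le_trans (le_bigmax _ _ i).
by apply: ub_le_sup; [exact: path_coord_bounded|exists t].
Qed.

Lemma path_norm_ge0 (f : C) : 0 <= path_norm f.
Proof. exact: bigmax_ge_id. Qed.

Lemma path_norm_le (f : C) e :
  0 <= e -> (forall t i, `|f t ord0 i| <= e) -> path_norm f <= e.
Proof.
move=> e0 fe; apply/bigmax_leP; split => // i _.
have [->|ne] := eqVneq (range (fun t => `|f t ord0 i|)) set0.
  by rewrite sup0.
by apply: ge_sup; [exact/set0P|move=> _ [t _ <-]].
Qed.

Fact path_normD (f g : C) : path_norm (f + g) <= path_norm f + path_norm g.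
Proof.
apply: path_norm_le => [|t i]; first by rewrite addr_ge0// path_norm_ge0.
rewrite path_addE mxE (le_trans (ler_normD _ _))// lerD//;
  exact: path_norm_ge_coord.
Qed.

Fact path_normZ (a : R) (f : C) : path_norm (a *: f) = `|a| * path_norm f.
Proof.
have leZ b (g : C) : path_norm (b *: g) <= `|b| * path_norm g.
  apply: path_norm_le => [|t i]; first by rewrite mulr_ge0// path_norm_ge0.
  by rewrite path_scaleE mxE normrM ler_wpM2l// path_norm_ge_coord.
have [->|a0] := eqVneq a 0.
  apply/eqP; rewrite normr0 mul0r eq_le path_norm_ge0 andbT.
  by rewrite (le_trans (leZ _ _))// normr0 mul0r.
apply/eqP; rewrite eq_le leZ/= -ler_pdivlMl ?normr_gt0//.
by rewrite -normfV (le_trans _ (leZ _ _))// scalerA mulVf// scale1r.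
Qed.

Fact path_norm0 (f : C) : path_norm f = 0 -> f = 0.
Proof.
move=> f0; apply: pathP => t; apply/rowP => i; rewrite path_zeroE mxE.
by apply/eqP; rewrite -normr_le0 -f0 path_norm_ge_coord.
Qed.

HB.instance Definition _ :=
  Lmodule_isNormed.Build R C path_normD path_normZ path_norm0.

Lemma path_normE (f : C) :
  `|f| = \big[Num.max/0]_(i < d) sup (range (fun t => `|f t ord0 i|)).
Proof. by []. Qed.

HB.instance Definition _ := @isMeasurable.Build (sigma_display (@open C)) C
  <<s @open C >> (@sigma_algebra0 _ setT _) (@sigma_algebraC _ _)
  (@sigma_algebra_bigcup _ setT _).

End paths_norm.

Section sub_gaussian_diameter.
Local Open Scope ereal_scope.
Context (R : realType) (d : measure_display) (X : measurableType d).
Variables (dist : X -> X -> R) (pi : probability X R).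

(* E[exp(lambda * epsilon * dist(X, X'))] on the canonical product space of   *)
(* (X, X', epsilon); epsilon is the fair coin b read as the sign (-1)^b.      *)
Definition sym_dist_mgf (lambda : R) : \bar R :=
  \int[(pi \x pi) \x bernoulli_prob 2^-1]_w
    (expR (lambda * ((-1) ^+ (w.2 : bool) * dist w.1.1 w.1.2)))%:E.

Definition sub_gaussian_params : set R :=
  [set sigma | (0 <= sigma)%R /\ forall lambda : R,
    sym_dist_mgf lambda <= (expR (sigma ^+ 2 * lambda ^+ 2 / 2))%:E].

(* The infimum is +oo if there is no admissible sigma, and otherwise it is    *)
(* attained: see sub_gaussian_diameter_least.                                 *)
Definition sub_gaussian_diameter : \bar R :=
  ereal_inf (EFin @` sub_gaussian_params).

Lemma sub_gaussian_diameter_least : sub_gaussian_diameter < +oo ->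
  sub_gaussian_params (fine sub_gaussian_diameter) /\
  forall sigma, sub_gaussian_params sigma ->
    (fine sub_gaussian_diameter <= sigma)%R.
Proof.
set D := sub_gaussian_diameter => Doo.
have D0 : 0 <= D by apply: le_ereal_inf_tmp => _ [s [s0 _] <-]; rewrite lee_fin.
have Dfin : D \is a fin_num by rewrite ge0_fin_numE.
split; last first.
  by move=> s Ss; rewrite -lee_fin fineK//; apply: ereal_inf_lbound; exists s.
split=> [|l]; first exact: fine_ge0.
have : (fun n : nat => (expR ((fine D + n.+1%:R^-1) ^+ 2 * l ^+ 2 / 2))%:E)
    @ \oo --> (expR (fine D ^+ 2 * l ^+ 2 / 2))%:E.
  apply: cvg_EFin; first exact: nearW.
  apply: (@continuous_cvg _ _ _ _ _ _ expR); first exact: continuous_expR.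
  apply: cvgMr_tmp; apply: cvgMr_tmp.
  have h : (fun n : nat => fine D + n.+1%:R^-1)%R @ \oo --> fine D.
    rewrite -[X in _ --> X]addr0; apply: cvgD; first exact: cvg_cst.
    exact: cvg_harmonic.
  by rewrite expr2; under eq_fun do rewrite expr2; exact: cvgM.
move=> cvgl; rewrite -(cvg_lim _ cvgl)//.
apply: lime_ge; first by apply/cvg_ex; eexists; exact: cvgl.
apply: nearW => n.
have : D < (fine D + n.+1%:R^-1)%:E.
  by rewrite EFinD fineK// lteDl// lte_fin.
move=> /ereal_inf_lt[_ [s [s0 Ss] <-]]; rewrite lte_fin => sD.
apply: (le_trans (Ss l)); rewrite lee_fin ler_expR.
apply: ler_wpM2r => //; apply: ler_wpM2r; first exact: sqr_ge0.
by apply: lerXn2r; rewrite ?nnegrE ?(ltW sD)// (ltW (le_lt_trans s0 sD)).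
Qed.

End sub_gaussian_diameter.

Section iid.
Context (R : realType) (d d' : measure_display).
Context (Omega : measurableType d) (E : measurableType d').

Definition mutually_independent (P : probability Omega R) (N : nat)
    (Z : 'I_N -> {RV P >-> E}) : Prop :=
  forall (J : {set 'I_N}) (A : 'I_N -> set E), (forall i, measurable (A i)) ->
    P [set w | forall i, i \in J -> A i (Z i w)] =
    (\prod_(i in J) P (Z i @^-1` A i))%E.

Definition iid_with_law (P : probability Omega R) (N : nat)
    (Z : 'I_N -> {RV P >-> E}) (pi : probability E R) : Prop :=
  mutually_independent Z /\
  forall i (A : set E), measurable A -> distribution P (Z i) A = pi A.

End iid.

Definition starts_at (R : realType) (T : R) (d : nat) (x : 'rV[R]_d) :
    set (paths T d) :=
  [set z | forall t : set_type `[0, T]%classic, set_val t = 0 -> z t = x].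

Definition expected_cost (R : realType) (T : R) (d : nat)
    (pi : probability (paths T d) R) (Jt : paths T d -> R) (F : paths T d) : R :=
  (\int[pi]_z Jt (z + F))%R.

Definition empirical_cost (R : realType) (T : R) (d N : nat)
    (Jt : paths T d -> R) (z : 'I_N -> paths T d) (F : paths T d) : R :=
  N%:R^-1 * \sum_(i < N) Jt (z i + F).

(* Main.v *)
(* Only the concentration of the empirical cost at the single point F is needed:
   E[sup_G (J G - Jhat G)] >= E[J F - Jhat F] = 0, so the expected supremum can
   only enlarge the right-hand side.

   For f z = - Jt (z + F), centered at its mean, let A l = E[e^(l f)].  Jensen
   gives A (- l) >= 1, hence
     A l <= A l * A (- l) = E[cosh (l (f X - f X'))]
         <= E[cosh (l kappa d(X, X'))] <= e^((kappa Delta l)^2 / 2),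
   the last expectation being the moment generating function that defines the
   sub-Gaussian diameter.  Independence and Chernoff's bound conclude. *)
From HB Require Import structures.
Require Import Defs.
From mathcomp Require Import all_boot all_order all_algebra.
From mathcomp Require Import all_classical all_reals all_analysis.
From mathcomp Require Import measurable_realfun.
From mathcomp Require Import ring lra.

Set Implicit Arguments.
Unset Strict Implicit.
Unset Printing Implicit Defensive.

Import Order.TTheory GRing.Theory Num.Theory.
Import numFieldNormedType.Exports.

Local Open Scope classical_set_scope.
Local Open Scope ring_scope.

(** * Preliminaries on integrals *)

(* [ge0_le_integral] asks for measurability, which is not available for the
   supremum over FF. *)
Lemma le_integral_pointwise d (T : measurableType d) (R : realType)
    (mu : {measure set T -> \bar R}) (f g : T -> \bar R) :
  (forall x, f x <= g x)%E -> (\int[mu]_x f x <= \int[mu]_x g x)%E.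
Proof.
move=> fg; rewrite /integral !patch_setT.
apply: leeB; apply: le_ereal_sup => _ [h hf <-]; exists h => // t.
- apply: (le_trans (hf t)); rewrite !funeposE.
  by rewrite ge_max !le_max fg lexx orbT.
- apply: (le_trans (hf t)); rewrite !funenegE.
  by rewrite ge_max !le_max leeN2 fg lexx orbT.
Qed.

(** Turns expectations of simple functions into finite real sums, where distributivity is available.
    The [c i] may be negative, so linearity goes through integrability of the indicators. *)
Lemma integral_sum_indic d (T : measurableType d) (R : realType)
    (P : probability T R) (I : finType) (c : I -> R) (A : I -> set T) :
  (forall i, measurable (A i)) ->
  (\int[P]_x (\sum_i c i * \1_(A i) x)%:E = (\sum_i c i * fine (P (A i)))%:E)%E.
Proof.
move=> mA.
have intA i : P.-integrable setT (fun x => (\1_(A i) x)%:E).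
  exact: integrable_indic.
under eq_integral do rewrite -sumEFin.
rewrite integral_sum//=; last first.
  move=> i; under eq_fun do rewrite EFinM; exact: integrableZl.
rewrite -sumEFin; apply: eq_bigr => i _.
under eq_integral do rewrite EFinM.
rewrite integralZl// integral_indic// setIT EFinM fineK//.
exact: fin_num_measure.
Qed.

(** * Expectation of a product of independent factors *)

Section independence.
Context (R : realType) (d d' : measure_display).
Context (Omega : measurableType d) (E : measurableType d').
Variables (P : probability Omega R) (N : nat) (Z : 'I_N -> {RV P >-> E}).
Hypothesis Z_indep : mutually_independent Z.

Import HBNNSimple.

(** Independence speaks of events only. Expanding each [h i] over its level sets and distributing
    the product turns both sides into sums over all choices of one value per index, which agree term
    by term by independence of the level sets. *)
Lemma expectation_prod_nnsfun (h : 'I_N -> {nnsfun E >-> R}) :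
  (\int[P]_w (\prod_(i < N) h i (Z i w))%:E =
   \prod_(i < N) \int[P]_w (h i (Z i w))%:E)%E.
Proof.
(* One finite set of values shared by all [h i], so that a choice of values is a function from
   indices to [V]. *)
have : finite_set (\bigcup_(i : 'I_N) range (h i)).
  by apply: bigcup_finite => // i _; exact: fimfunP.
move/finite_seqP => [s hs].
pose V : finType := seq_sub s.
pose B (i : 'I_N) (v : V) := h i @^-1` [set val v].
have mB i v : measurable (B i v) by exact: measurable_funPTI.
have mZB i v : measurable (Z i @^-1` B i v) by exact: measurable_funPTI.
have hE i e : h i e = \sum_(v : V) val v * \1_(B i v) e.
  have hV : h i e \in s.
    suff : [set` s] (h i e) by [].
    by rewrite -hs; exists i => //; exists e.
  rewrite (bigD1 (SeqSub hV : V))//= big1 ?addr0.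
    by rewrite indicE mem_set ?mulr1.
  move=> v vh; rewrite indicE memNset ?mulr0// => /= hv.
  by move/eqP: vh; apply; apply: val_inj.
(* The product of indicators is the indicator of the joint event, written with the full index set as
   [J] in [mutually_independent]. *)
have prod_indic (f : {ffun 'I_N -> V}) w :
    \prod_(i < N) (val (f i) * \1_(B i (f i)) (Z i w)) =
    \prod_(i < N) val (f i) *
    \1_([set w | forall i, i \in [set: 'I_N]%SET -> B i (f i) (Z i w)]) w :> R.
  rewrite big_split/=; congr (_ * _); rewrite [RHS]indicE.
  have [/set_mem/= Bw|nBw] := boolP (w \in _).
    rewrite big1// => i _; rewrite indicE mem_set//.
    by apply: Bw; rewrite finset.in_setT.
  have [i Bi] : exists i, ~ B i (f i) (Z i w).
    by apply/existsNP => Bw; move/negP: nBw; apply; exact/mem_set.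
  by rewrite (bigD1 i)//= indicE memNset// mul0r.
under eq_integral => w _.
  under eq_bigr do rewrite hE.
  rewrite bigA_distr_bigA/=; under eq_bigr do rewrite prod_indic.
  over.
rewrite integral_sum_indic; last first.
  move=> f; rewrite [X in measurable X](_ : _ =
      \bigcap_(i : 'I_N) (Z i @^-1` B i (f i))).
    by apply: fin_bigcap_measurable => // i _.
  by apply/seteqP; split=> w /= Bw i _;
    [apply: Bw; rewrite finset.in_setT|exact: Bw].
under [RHS]eq_bigr => i _.
  under eq_integral do rewrite hE.
  rewrite (@integral_sum_indic _ _ _ P _ _ (fun v => Z i @^-1` B i v))//.
  over.
rewrite /=; apply/esym; apply: etrans (prodEFin _ _ _) _.
rewrite bigA_distr_bigA/=; congr EFin; apply: eq_bigr => f _.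
rewrite big_split/=; congr (_ * _).
rewrite (Z_indep _ (fun i => mB i (f i))) -[LHS]/(fine _%:E); congr fine.
apply: etrans (esym (prodEFin _ _ _)) _.
by apply: eq_big => i; rewrite ?finset.in_setT// fineK// fin_num_measure.
Qed.

(** Passage from simple to measurable functions by monotone convergence. The real bounds [c i] make
    every factor finite, so the approximating products can be compared in [R]. *)
Lemma expectation_prod_le (g : 'I_N -> E -> R) (c : 'I_N -> R) :
  (forall i, measurable_fun setT (g i)) -> (forall i e, 0 <= g i e) ->
  (forall i, \int[P]_w (g i (Z i w))%:E <= (c i)%:E)%E ->
  (\int[P]_w (\prod_(i < N) g i (Z i w))%:E <= (\prod_(i < N) c i)%:E)%E.
Proof.
move=> mg g0 gc.
have mgE i : measurable_fun setT (fun e => (g i e)%:E).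
  exact/measurable_EFinP.
pose h n i := nnsfun_approx measurableT (mgE i) n.
have hg i e : h n i e @[n --> \oo] --> g i e.
  have := @cvg_nnsfun_approx _ _ _ _ measurableT _ (mgE i) _ e I.
  by move=> /(_ (fun e _ => g0 i e))/fine_cvgP[].
have hh i e n m : (n <= m)%N -> h n i e <= h m i e.
  by move=> nm; apply/lefP/nd_nnsfun_approx.
have hleg n i e : h n i e <= g i e.
  rewrite -(cvg_lim _ (hg i e))//; apply: nondecreasing_cvgn_le.
    by move=> a b; exact: hh.
  by apply/cvg_ex; eexists; exact: hg.
pose H n w := (\prod_(i < N) h n i (Z i w))%:E.
have Hcvg w : H n w @[n --> \oo] --> (\prod_(i < N) g i (Z i w))%:E.
  apply: cvg_EFin; first exact: nearW.
  apply: cvg_big => //; exact: mul_continuous.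
rewrite [leLHS](_ : _ = \int[P]_w limn (H^~ w))%E; last first.
  by apply: eq_integral => w _; rewrite (cvg_lim _ (Hcvg w)).
have mH n : measurable_fun setT (H n).
  apply/measurable_EFinP; apply: measurable_prod => i _.
  exact: measurableT_comp.
have mono : (\int[P]_w H n w @[n --> \oo] --> \int[P]_w limn (H^~ w))%E.
  apply: cvg_monotone_convergence => //.
    by move=> n w _; rewrite lee_fin; apply: prodr_ge0.
  move=> w _ n m nm; rewrite lee_fin; apply: ler_prod => i _.
  by rewrite hh// andbT.
rewrite -(cvg_lim _ mono)//; apply: lime_le.
  by apply/cvg_ex; eexists; exact: mono.
apply: nearW => n; rewrite /H expectation_prod_nnsfun.
have hint i : (0 <= \int[P]_w (h n i (Z i w))%:E <= (c i)%:E)%E.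
  rewrite integral_ge0 => [|w _]; last by rewrite lee_fin.
  apply: le_trans (gc i); apply: le_integral_pointwise => w.
  by rewrite lee_fin hleg.
have hfin i : (\int[P]_w (h n i (Z i w))%:E)%E \is a fin_num.
  case/andP: (hint i) => ? ?; rewrite ge0_fin_numE//.
  by apply: le_lt_trans (ltry (c i)).
rewrite (eq_bigr _ (fun i _ => esym (fineK (hfin i)))).
apply: le_trans (_ :
  (\prod_(i < N) fine (\int[P]_w (h n i (Z i w))%:E))%:E <= _)%E.
  by rewrite prodEFin.
rewrite lee_fin; apply: ler_prod => i _.
by rewrite -!lee_fin fineK.
Qed.

End independence.

(** * Symmetrization and the sub-Gaussian diameter *)

(** Up to a factor 2 this is cosh, which is even and nondecreasing on the nonnegative reals; it
    turns a Lipschitz bound into a bound between symmetrized exponentials. *)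
Lemma le_expRD_expRN (R : realType) (x y : R) :
  `|x| <= `|y| -> expR x + expR (- x) <= expR y + expR (- y).
Proof.
have abs (z : R) : expR z + expR (- z) = expR `|z| + expR (- `|z|).
  by have [z0|z0] := ler0P z; rewrite ?opprK 1?addrC.
move=> xy; rewrite (abs x) (abs y).
set a := `|x| in xy *; set b := `|y| in xy *.
have a0 : 0 <= a by exact: normr_ge0.
(* The increment of 2 cosh factors as a product; both factors are nonnegative when [0 <= a <= b]. *)
have -> : expR b + expR (- b) = expR a + expR (- a) +
    (expR b - expR a) * (1 - expR (- a) * expR (- b)).
  have := expRxMexpNx_1 a; have := expRxMexpNx_1 b.
  set ea := expR a; set ena := expR (- a).
  set eb := expR b; set enb := expR (- b).
  move=> hb ha.
  transitivity (ea + ena + (eb - ea - (eb * enb) * ena + (ea * ena) * enb));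
    last by ring.
  by rewrite ha hb; ring.
rewrite lerDl mulr_ge0//; first by rewrite subr_ge0 ler_expR.
rewrite subr_ge0 -expRD -[leRHS]expR0 ler_expR -opprD oppr_le0.
by rewrite addr_ge0// (le_trans a0).
Qed.

Section subgaussian.
Context (R : realType) (d : measure_display) (X : measurableType d).
Variables (dist : X -> X -> R) (pi : probability X R).
Hypothesis measurable_dist :
  measurable_fun setT (fun z : X * X => dist z.1 z.2).

(** By Tonelli the coin is integrated first; its two equally likely signs leave the cosh of
    [l * dist]. *)
Lemma sym_dist_mgfE (l : R) : sym_dist_mgf dist pi l =
  (\int[pi \x pi]_z
     ((expR (l * dist z.1 z.2) + expR (- (l * dist z.1 z.2))) / 2)%:E)%E.
Proof.
rewrite /sym_dist_mgf.
have msign : measurable_fun setT (fun w : X * X * bool => (-1) ^+ w.2 : R).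
  exact: (@measurableT_comp _ _ _ _ _ _
    (fun b : bool => (-1) ^+ b : R) _ snd).
have mdist : measurable_fun setT (fun w : X * X * bool => dist w.1.1 w.1.2).
  exact: (@measurableT_comp _ _ _ _ _ _ (fun z => dist z.1 z.2) _ fst).
have mexp : measurable_fun setT (fun w : X * X * bool =>
    (expR (l * ((-1) ^+ w.2 * dist w.1.1 w.1.2)))%:E).
  apply/measurable_EFinP.
  apply: (@measurableT_comp _ _ _ _ _ _ expR); first exact: measurable_expR.
  apply: measurable_funM; first exact: measurable_cst.
  exact: measurable_funM.
have f0 (w : X * X * bool) :
    (0 <= (expR (l * ((-1) ^+ w.2 * dist w.1.1 w.1.2)))%:E :> \bar R)%E.
  by rewrite lee_fin expR_ge0.
pose m1 : probability (X * X)%type R := (pi \x pi)%E.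
pose m2 : probability bool R := bernoulli_prob (2^-1 : R).
apply: (etrans (@fubini_tonelli1 _ _ _ _ _ m1 m2 _ mexp f0)).
rewrite {}/m1 {}/m2.
apply: eq_integral => z _; rewrite /fubini_F.
rewrite integral_bernoulli_prob/=.
- rewrite -!EFinM -EFinD; congr EFin.
  rewrite expr0 expr1 mul1r mulN1r mulrN /unstable.onem.
  by field.
- by rewrite invr_ge0 invf_le1//= ?ler0n ?ler1n.
- by move=> b; rewrite lee_fin expR_ge0.
Qed.

Lemma integrable_centered (f : X -> R) :
  pi.-integrable setT (EFin \o f) ->
  pi.-integrable setT (fun x => (f x - \int[pi]_y f y)%:E).
Proof.
move=> intf; under eq_fun do rewrite EFinB.
by apply: integrableB => //; exact: finite_measure_integrable_cst.
Qed.

Lemma integral_centered (f : X -> R) :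
  pi.-integrable setT (EFin \o f) ->
  (\int[pi]_x (f x - \int[pi]_y f y)%R%:E = 0)%E.
Proof.
move=> intf; under eq_integral do rewrite EFinB.
rewrite integralB//; last exact: finite_measure_integrable_cst.
rewrite integral_cst// [X in (_ * X)%E](probability_setT pi) mule1.
by rewrite -[X in (X - _)%E]fineK ?integrable_fin_num// -EFinB subrr.
Qed.

(** Jensen's inequality through the tangent line at 0: [1 + u <= expR u], and the linear part has
    mean zero. *)
Lemma centered_mgf_ge1 (f : X -> R) (l : R) :
  pi.-integrable setT (EFin \o f) ->
  (1 <= \int[pi]_x (expR (l * (f x - \int[pi]_y f y)%R))%:E)%E.
Proof.
move=> intf; have intfm := integrable_centered intf.
have -> : (1 = \int[pi]_x (1 + l * (f x - \int[pi]_y f y)%R)%:E)%E.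
  under eq_integral do rewrite EFinD EFinM.
  rewrite integralD//; last exact: integrableZl.
    rewrite integral_cst// [X in (_ * X)%E](probability_setT pi) mule1.
    by rewrite integralZl// integral_centered// mule0 adde0.
  exact: finite_measure_integrable_cst.
by apply: le_integral_pointwise => x; rewrite lee_fin expR_ge1Dx.
Qed.

Lemma centered_mgf_le_sym_dist_mgf (f : X -> R) (k l : R) :
  pi.-integrable setT (EFin \o f) ->
  (forall z z', `|f z - f z'| <= k * dist z z') ->
  (\int[pi]_x (expR (l * (f x - \int[pi]_y f y)%R))%:E
    <= sym_dist_mgf dist pi (k * l))%E.
Proof.
move=> intf lipf; set m := (\int[pi]_y f y)%R.
have mf : measurable_fun setT f.
  by apply/measurable_EFinP; case/integrableP: intf.
have mexp (c : R) : measurable_fun setT (fun x => (expR (c * (f x - m)))%:E).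
  apply/measurable_EFinP; apply: measurableT_comp => //.
  by apply: measurable_funM => //; apply: measurable_funB.
pose A c := (\int[pi]_x (expR (c * (f x - m)))%:E)%E.
have A0 c : (0 <= A c)%E.
  by apply: integral_ge0 => x _; rewrite lee_fin expR_ge0.
pose h (z : X * X) := f z.1 - f z.2.
have mh : measurable_fun setT h.
  apply: measurable_funB; exact: measurableT_comp.
have mexph c : measurable_fun setT (fun z => (expR (c * h z))%:E).
  apply/measurable_EFinP; apply: measurableT_comp => //.
  exact: measurable_funM.
(* [h] is a difference of two independent copies, so the mean [m] cancels and Tonelli factors the
   exponential moment. *)
have AA c : (\int[pi \x pi]_z (expR (c * h z))%:E = A c * A (- c)%R)%E.
  rewrite fubini_tonelli1//.
  rewrite /A muleC -ge0_integralZl//; last exact: A0.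
  apply: eq_integral => x _; rewrite muleC -ge0_integralZl//.
  apply: eq_integral => y _; rewrite -EFinM -expRD; congr (expR _)%:E.
  by rewrite /h/=; ring.
apply: (@le_trans _ _ (A l * A (- l)%R))%E.
  rewrite -[leLHS]mule1 lee_wpmul2l//; [exact: A0|exact: centered_mgf_ge1].
rewrite sym_dist_mgfE.
(* [A l * A (- l)] is symmetric in [l], hence equals the average of the moments of [h] at [l] and
   [- l], whose integrand is a cosh. *)
apply: le_trans (_ :
  \int[pi \x pi]_z ((expR (l * h z) + expR (- l * h z)) / 2)%R%:E <= _)%E.
  under [leRHS]eq_integral do rewrite mulrDl EFinD !(mulrC _ 2^-1) !EFinM.
  rewrite ge0_integralD//=; [|exact: measurable_funeM..].
  rewrite !ge0_integralZl_EFin//.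
  rewrite !AA opprK [X in (_ + 2^-1%:E * X)%E]muleC -ge0_muleDl ?lee_fin//.
  by rewrite -EFinD (_ : _ + _ = 1) ?mul1e//; field.
apply: le_integral_pointwise => z; rewrite lee_fin ler_wpM2r//.
(* Only absolute values are compared, so the signs of [k] and [l] do not matter. *)
rewrite mulNr; apply: le_expRD_expRN; rewrite !normrM mulrAC.
rewrite [`|k| * _ * _]mulrC ler_wpM2l//.
by rewrite (le_trans (lipf _ _))// -normrM ler_norm.
Qed.

End subgaussian.

(** * Chernoff tail bound for i.i.d. sums *)

Section iid_tail.
Context (R : realType) (d d' : measure_display).
Context (Omega : measurableType d) (E : measurableType d').
Variables (P : probability Omega R) (N : nat) (Z : 'I_N -> {RV P >-> E}).
Variables (pi : probability E R).
Hypothesis Z_iid : iid_with_law Z pi.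

Lemma ge0_integral_law (i : 'I_N) (g : E -> \bar R) :
  measurable_fun setT g -> (forall e, 0 <= g e)%E ->
  (\int[P]_w g (Z i w) = \int[pi]_e g e)%E.
Proof.
move=> mg g0; rewrite -(ge0_integral_distribution (Z i) mg g0).
by apply: eq_measure_integral => A mA _; exact: Z_iid.2.
Qed.

Lemma integral_law (i : 'I_N) (g : E -> \bar R) :
  pi.-integrable setT g ->
  P.-integrable setT (g \o Z i) /\ (\int[P]_w g (Z i w) = \int[pi]_e g e)%E.
Proof.
move=> /integrableP[mg intg].
have iZ : P.-integrable setT (g \o Z i).
  apply/integrableP; split; first exact: measurableT_comp.
  rewrite (ge0_integral_law i (g := abse \o g)) => [//||e].
    exact: measurableT_comp.
  exact: abse_ge0.
split => //; rewrite -[LHS](integral_distribution mg iZ).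
by apply: eq_measure_integral => A mA _; exact: Z_iid.2.
Qed.

(** Chernoff's bound at the exponent [r]: independence splits the moment of the sum into [N] factors
    with the same bound. The choice of [r] is left for later. *)
Lemma iid_sub_gaussian_chernoff (f : E -> R) (v r a : R) :
  measurable_fun setT f -> 0 < r ->
  (\int[pi]_e (expR (r * f e))%:E <= (expR (v * r ^+ 2 / 2))%:E)%E ->
  (P [set w | a <= \sum_(i < N) f (Z i w)]%R
    <= (expR (N%:R * (v * r ^+ 2 / 2) - r * a))%:E)%E.
Proof.
move=> mf r0 mgf.
pose S w := \sum_(i < N) f (Z i w).
have mS : measurable_fun setT S.
  by apply: measurable_sum => i; exact: measurableT_comp.
pose X : {RV P >-> R} := HB.pack S (isMeasurableFun.Build _ _ _ _ S mS).
apply: le_trans (chernoff X a r0) _.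
rewrite expRD EFinM lee_wpmul2r ?lee_fin ?expR_ge0//.
rewrite /mmt_gen_fun unlock expRM_natl.
have -> : expR (v * r ^+ 2 / 2) ^+ N = \prod_(i < N) expR (v * r ^+ 2 / 2).
  by rewrite prodr_const card_ord.
have mexp : measurable_fun setT (fun e => expR (r * f e)).
  by apply: measurableT_comp => //; exact: measurable_funM.
apply: le_trans (expectation_prod_le Z_iid.1
  (g := fun _ e => expR (r * f e)) _ _ _) => //.
- apply: le_integral_pointwise => w /=; rewrite lee_fin -expR_sum.
  by rewrite ler_expR mulrC /X/= /S mulr_sumr.
- move=> i; rewrite (ge0_integral_law i (g := fun e => (expR (r * f e))%:E))//.
  exact/measurable_EFinP.
Qed.

(** The bound is proved at each level strictly above the threshold and then passed to the strict
    event in the limit. *)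
Lemma iid_sub_gaussian_tail (f : E -> R) (v delta : R) :
  measurable_fun setT f -> 0 <= v -> (0 < N)%N -> 0 < delta < 1 ->
  (forall r : R, 0 < r ->
    (\int[pi]_e (expR (r * f e))%:E <= (expR (v * r ^+ 2 / 2))%:E)%E) ->
  (P [set w | Num.sqrt (2 * v * ln (1 / delta) / N%:R) <
              N%:R^-1 * \sum_(i < N) f (Z i w)]%R
    <= delta%:E)%E.
Proof.
move=> mf v0 N0 /andP[delta0 delta1] mgf.
set L := ln (1 / delta); set t := Num.sqrt _.
have L0 : 0 < L by rewrite ln_gt0// div1r invf_gt1.
have NR0 : 0 < N%:R :> R by rewrite ltr0n.
have mS : measurable_fun setT (fun w => \sum_(i < N) f (Z i w)).
  by apply: measurable_sum => i; exact: measurableT_comp.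
(* Such an [s] is positive even when [t] is 0, so dividing by it is legitimate. *)
have tail s : t < s ->
    (P [set w | (N%:R * s <= \sum_(i < N) f (Z i w))%R] <= delta%:E)%E.
  move=> ts; have s0 : 0 < s by rewrite (le_lt_trans _ ts)// sqrtr_ge0.
  (* The exponent minimising the bound would divide by [v], which may be 0;
     this one costs nothing because [2 v L / N = t^2 < s^2]. *)
  have r0 : 0 < 2 * L / (N%:R * s) by rewrite divr_gt0 ?mulr_gt0.
  apply: le_trans (iid_sub_gaussian_chernoff _ mf r0 (mgf _ r0)) _.
  rewrite lee_fin.
  have -> : delta = expR (- L).
    by rewrite /L div1r lnV ?posrE// opprK lnK.
  rewrite ler_expR.
  have t2s : 2 * v * L / N%:R <= s ^+ 2.
    rewrite -ler_sqrt ?exprn_ge0 ?(ltW s0)//.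
    by rewrite sqrtr_sqr gtr0_norm// ltW.
  (* The quadratic term is [L] times [t^2 / s^2], hence at most [L], against [- 2 L] from the linear
     term. *)
  have -> : N%:R * (v * (2 * L / (N%:R * s)) ^+ 2 / 2) -
      2 * L / (N%:R * s) * (N%:R * s) =
      - L + L * (2 * v * L / N%:R / s ^+ 2 - 1).
    by field; rewrite !gt_eqF.
  rewrite gerDl mulr_ge0_le0 ?(ltW L0)// subr_le0 ler_pdivrMr ?exprn_gt0//.
  by rewrite mul1r.
(* The levels decrease to [t], so the [A n] increase to the strict event and continuity of [P] from
   below applies. *)
pose A n := [set w | N%:R * (t + n.+1%:R^-1) <= \sum_(i < N) f (Z i w)].
have mA n : measurable (A n).
  by rewrite /A -preimage_itvcy -[X in measurable X]setTI; exact: mS.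
have -> : [set w | t < N%:R^-1 * \sum_(i < N) f (Z i w)] = \bigcup_n A n.
  apply/seteqP; split => w /=.
    move=> /ltr_add_invr[k tk]; exists k => //.
    by rewrite /A/= -ler_pdivlMl// ltW.
  move=> [n _]; rewrite /A/= -ler_pdivlMl//; apply: lt_le_trans.
  by rewrite ltrDl.
have ndA : {homo A : n m / (n <= m)%N >-> (n <= m)%O}.
  move=> n m nm; apply/subsetPset => w /=; rewrite /A/=; apply: le_trans.
  by rewrite ler_wpM2l ?(ltW NR0)// lerD2l lef_pV2 ?posrE// ler_nat.
have cvgA := nondecreasing_cvg_mu (mu := P) mA
  (bigcup_measurable (fun n _ => mA n)) ndA.
rewrite -(cvg_lim _ cvgA)//.
apply: lime_le; first by apply/cvg_ex; eexists; exact: cvgA.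
by apply: nearW => n; apply: tail; rewrite ltrDl.
Qed.

End iid_tail.

(** * Measurability on path space *)

Section paths_measurability.
Context (R : realType) (T : R) (d : nat).
Local Notation C := (paths T d).
Local Notation I := (set_type `[0, T]%classic).

Lemma continuous_measurable_paths (g : C -> R) :
  continuous g -> measurable_fun setT g.
Proof.
move=> /continuousP cg; apply: (measurability _ (RGenOpens.measurableE R)).
move=> _ [_ [a [b ->] <-]]; rewrite setTI.
by apply: sub_sigma_algebra; exact/cg/interval_open.
Qed.

Lemma lipschitz_measurable_paths (g : C -> R) (k : R) :
  (forall z z', `|g z - g z'| <= k * `|z - z'|) -> measurable_fun setT g.
Proof.
move=> gk; apply: continuous_measurable_paths => z A /nbhs_ballP[e /= e0 eA].
(* A positive Lipschitz constant whatever the sign of [k]. *)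
have k1 : 0 < `|k| + 1 by rewrite ltr_wpDl.
apply/nbhs_ballP; exists (e / (`|k| + 1)) => /=; first by rewrite divr_gt0.
move=> y; rewrite -ball_normE/= ltr_pdivlMr// => zy; apply: eA.
rewrite /ball/= (le_lt_trans (gk z y))// (le_lt_trans _ zy)// mulrC ler_wpM2l//.
by rewrite (le_trans (ler_norm k))// lerDl.
Qed.

Lemma measurable_path_coord (t : I) (i : 'I_d) :
  measurable_fun setT (fun z : C => z t ord0 i).
Proof.
apply: (@lipschitz_measurable_paths _ 1) => z z'; rewrite mul1r.
have := path_norm_ge_coord (z - z') t i.
by rewrite path_addE path_oppE !mxE.
Qed.

Hypothesis T_gt0 : 0 < T.

(** Clamping extends every path continuously to the whole line, so that density of the rationals in
    [R] can be used, even when the endpoint [T] is irrational. *)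
Let clamp_subproof (s : R) : Num.min (Num.max s 0) T \in `[0, T]%classic.
Proof.
by rewrite inE/= in_itv/= le_min le_max lexx orbT (ltW T_gt0) ge_min lexx orbT.
Qed.

Let clamp (s : R) : I := SigSub (clamp_subproof s).

Let continuous_clamp : continuous clamp.
Proof.
apply: continuous_comp_initial => s.
apply: (@continuous_min R R (fun s => Num.max s 0) (cst T) s);
  last exact: cst_continuous.
apply: (@continuous_max R R id (cst 0) s); last exact: cst_continuous.
exact: cvg_id.
Qed.

(* The distance is a supremum over rational times only, which makes it
   measurable for the product sigma-algebra without separability of C. *)
Lemma measurable_path_dist :
  measurable_fun setT (fun z : C * C => `|z.1 - z.2|).
Proof.
apply: (measurability _ (RGenOInfty.measurableE R)).
move=> _ [_ [a ->] <-]; rewrite setTI preimage_itvoy.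
(* A negative level gives the whole space; otherwise [0 <= a] is what [path_norm_le] requires
   below. *)
have [a0|a0] := ltP a 0.
  rewrite [X in measurable X](_ : _ = setT)//.
  by apply/seteqP; split => // z _ /=; exact: lt_le_trans a0 _.
rewrite [X in measurable X](_ : _ = \bigcup_(q : rat) \bigcup_(i : 'I_d)
   [set z : C * C |
     a < `|z.1 (clamp (ratr q)) ord0 i - z.2 (clamp (ratr q)) ord0 i|]).
  apply: bigcupT_measurable_rat => q; apply: fin_bigcup_measurable => // i _.
  rewrite -preimage_itvoy -[X in measurable X]setTI.
  suff: measurable_fun setT (fun z : C * C =>
    `|z.1 (clamp (ratr q)) ord0 i - z.2 (clamp (ratr q)) ord0 i|) by exact.
  apply: measurableT_comp => //; apply: measurable_funB.
    exact: (measurableT_comp (measurable_path_coord _ _) measurable_fst).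
  exact: (measurableT_comp (measurable_path_coord _ _) measurable_snd).
apply/seteqP; split => z /=.
  move=> az; apply: contrapT => nz.
  move: az; apply/negP; rewrite -leNgt; apply: path_norm_le => // t i.
  rewrite leNgt; apply/negP => at_.
  pose u s := `|(z.1 - z.2) (clamp s) ord0 i|.
  have cu : continuous u.
    move=> s; apply: continuous_comp; last exact: norm_continuous.
    apply: (@continuous_comp _ _ _ clamp (fun t => (z.1 - z.2) t ord0 i)).
      exact: continuous_clamp.
    apply: (@continuous_comp _ _ _ _ (fun M : 'rV[R]_d => M ord0 i)).
      exact: path_continuous.
    exact: coord_continuous.
  have clampt : clamp (set_val t) = t.
    apply: val_inj => /=; have := set_valP t.
    by rewrite /= in_itv/= => /andP[t0 tT]; rewrite max_l// min_l.
  (* The superlevel set of [u] is open and contains [t], so it holds a rational time, contradicting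
     [nz]. *)
  have [] := @dense_rat R [set s | a < u s].
  - by exists (set_val t); rewrite /= /u clampt.
  - rewrite -preimage_itvoy; apply: open_comp => // s _; exact: cu.
  move=> s [/= aus [q _ qs]]; apply: nz; exists q => //; exists i => //.
  by move: aus; rewrite -qs /u path_addE path_oppE !mxE.
move=> [q _ [i _]] /lt_le_trans; apply.
have := path_norm_ge_coord (z.1 - z.2) (clamp (ratr q)) i.
by rewrite path_addE path_oppE !mxE.
Qed.

End paths_measurability.

(** * Assembly of the deviation bound at [F] *)

Theorem proposition3 (R : realType) (T : R) (d : nat)
  (T_gt0 : 0 < T) (d_gt0 : (0 < d)%N)
  (FF : set (paths T d))
  (FF_nonempty : FF !=set0) (FF_convex : convex_set FF) (FF_compact : compact FF)
  (x : 'rV[R]_d) (pi : probability (paths T d) R)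
  (pi_start : pi (@starts_at R T d x) = 1%E)
  (disp : measure_display) (Omega : measurableType disp)
  (P : probability Omega R)
  (N : nat) (N_gt0 : (0 < N)%N) (Z : 'I_N -> {RV P >-> paths T d})
  (Z_iid : iid_with_law Z pi)
  (Jt : paths T d -> R) (kappa : R)
  (Jt_lipschitz : forall F, FF F -> forall z z' : paths T d,
     `|Jt (z + F) - Jt (z' + F)| <= kappa * `|z - z'|)
  (Jt_integrable : (\int[pi]_z (`|Jt z|)%:E < +oo)%E)
  (SG_finite :
     (sub_gaussian_diameter (fun z z' : paths T d => `|z - z'|%R) pi < +oo)%E)
  (F : paths T d) (F_FF : FF F) (delta : R) (delta01 : 0 < delta < 1) :
  let J := expected_cost pi Jt in
  let Jhat w := empirical_cost Jt (fun i => Z i w) in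
  let Delta :=
    fine (sub_gaussian_diameter (fun z z' : paths T d => `|z - z'|) pi) in
  ((1 - delta)%R%:E <=
   P [set w | (J F)%:E <=
        (Jhat w F)%:E
        + \int[P]_w' ereal_sup [set (J G - Jhat w' G)%R%:E | G in FF]
        + (Num.sqrt (2 * kappa ^+ 2 * Delta ^+ 2 * ln (1 / delta) / N%:R))%R%:E])%E.
Proof.
lazy zeta; set J := expected_cost pi Jt.
set Jhat := fun w => empirical_cost Jt _; set Delta := fine _.
(* Translation by [F] is onto, so the bound at the single point [F] is a Lipschitz bound for [Jt]
   itself. *)
have lip u u' : `|Jt u - Jt u'| <= kappa * `|u - u'|.
  have := Jt_lipschitz _ F_FF (u - F) (u' - F).
  by rewrite !subrK opprB addrA subrK.
(* The sign turns an excess of [J F] over the empirical cost into an upper deviation of the mean of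
   [f]. *)
pose f (z : paths T d) := - Jt (z + F).
have lipf z z' : `|f z - f z'| <= kappa * `|z - z'|.
  by rewrite /f -opprD normrN; exact: Jt_lipschitz.
have mf : measurable_fun setT f by exact: (lipschitz_measurable_paths lipf).
have mJt : measurable_fun setT Jt by exact: (lipschitz_measurable_paths lip).
(* The Lipschitz bound dominates [f] by the absolute value of [Jt] plus a constant. *)
have intf : pi.-integrable setT (EFin \o f).
  have intJt : pi.-integrable setT (EFin \o Jt).
    by apply/integrableP; split => //; exact/measurable_EFinP.
  have intc := finite_measure_integrable_cst pi (kappa * `|F|) measurableT.
  have := integrableD measurableT (integrable_norm intJt) intc.
  apply: le_integrable => //; first exact/measurable_EFinP.
  move=> z _ /=; rewrite lee_fin [leRHS]ger0_norm ?addr_ge0//; last first.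
    (* The sign of [kappa] is not given; that of its product with the norm of [F] follows from the
       Lipschitz bound between [F] and 0. *)
    by have := lip F 0; rewrite subr0; exact: le_trans.
  rewrite /f normrN (_ : Jt (z + F) = Jt z + (Jt (z + F) - Jt z)); last by ring.
  rewrite (le_trans (ler_normD _ _))// lerD2l.
  by have := lip (z + F) z; rewrite addrAC subrr add0r.
pose m := (\int[pi]_z f z)%R.
have mE : m = - J F.
  rewrite /J /expected_cost (@eq_Rintegral _ _ _ pi setT (fun z => -1 * f z)).
    by rewrite RintegralZl// mulN1r opprK.
  by move=> z _; rewrite mulN1r opprK.
pose Y w := N%:R^-1 * \sum_(i < N) (f (Z i w) - m).
have NR0 : N%:R != 0 :> R by rewrite pnatr_eq0 -lt0n.
have YE w : Y w = J F - Jhat w F.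
  rewrite /Y sumrB sumr_const card_ord -[m *+ N]mulr_natl mulrBr mulKf//.
  by rewrite mE opprK addrC; congr (_ + _); rewrite -mulrN -sumrN.
have [[Delta0 Delta_mgf] _] := sub_gaussian_diameter_least SG_finite.
have tail : (P [set w | Num.sqrt (2 * (kappa ^+ 2 * Delta ^+ 2) *
    ln (1 / delta) / N%:R) < Y w]%R <= delta%:E)%E.
  apply: (iid_sub_gaussian_tail Z_iid (f := fun z => f z - m)) => //.
  - exact: measurable_funB.
  - by rewrite mulr_ge0 ?sqr_ge0.
  move=> r r0.
  (* The diameter is used at the parameter [kappa * r], which puts [kappa ^+ 2] into the variance
     proxy. *)
  have := centered_mgf_le_sym_dist_mgf (measurable_path_dist T_gt0) r intf lipf.
  move/le_trans; apply; apply: le_trans (Delta_mgf _) _.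
  by rewrite lee_fin ler_expR le_eqVlt exprMn mulrA [Delta ^+ 2 * _]mulrC eqxx.
have mY : measurable_fun setT Y.
  apply: measurable_funM => //; apply: measurable_sum => i.
  by apply: measurable_funB => //; exact: measurableT_comp.
have intfm := integrable_centered intf.
have EY0 : (\int[P]_w (Y w)%:E = 0)%E.
  have intZ i := integral_law Z_iid i intfm.
  under eq_integral do rewrite EFinM -sumEFin.
  rewrite integralZl//; last first.
    by apply: integrable_sum => // i _; exact: (intZ i).1.
  rewrite integral_sum//; last by move=> i; exact: (intZ i).1.
  rewrite big1 ?mule0// => i _.
  by rewrite [LHS](intZ i).2 integral_centered.
set I := (\int[P]_w' _)%E; set t := Num.sqrt _.
have I0 : (0 <= I)%E.
  rewrite -EY0; apply: le_integral_pointwise => w.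
  by apply: ereal_sup_ubound; exists F => //; rewrite YE.
have mt : measurable [set w | t < Y w].
  by rewrite -preimage_itvoy -[X in measurable X]setTI; exact: mY.
have {tail} : ((1 - delta)%:E <= P (~` [set w | t < Y w]%R))%E.
  rewrite probability_setC// EFinB leeB//.
  by move: tail; rewrite mulrA.
(* [I] is real or +oo, since [I0] rules out -oo. In the real case the event is [Y w <= r + t] and
   contains the complement of the tail event. *)
move/le_trans; apply; clearbody I; case: I I0 => [r|_|]; last by [].
  rewrite lee_fin => r0; apply: le_measure.
  - by rewrite inE; exact: measurableC.
  - rewrite inE [X in measurable X](_ : _ = [set w | Y w <= r + t]).
      by rewrite -preimage_itvNyc -[X in measurable X]setTI; exact: mY.
    apply/seteqP; split => w /=; rewrite YE -!EFinD lee_fin; lra.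
  move=> w /= /negP; rewrite -leNgt YE => Yt.
  rewrite -!EFinD lee_fin; lra.
(* With an infinite expected supremum the event is the whole space. *)
apply: le_trans (probability_le1 P (measurableC mt)) _.
rewrite -(probability_setT P) [X in (_ <= P X)%E](_ : _ = setT)//.
by apply/seteqP; split => // w _ /=; rewrite addey// addye// leey.
Qed.
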